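(* Let $d\geq 3$, $c>0$, and let $G=(V,E)$ be a $(c,d)$-expander with $|V|\geq 2$ and $V\subseteq X$. Let $E$ also denote the graph CNF $\bigwedge_{\{x,y\}\in E}(x\vee y)$ of $G$. Then $$\mathsf{DNNF}(E)\geq 2^{g(c,d)\,\mathsf{size}(E)-1},$$ where $g(c,d)=\frac{c\cdot f(d)}{6d^3}$ and $f(d)=\log_2(1+2^{-d})>0$.
   Context: Fix a countable set $X$ of variables; an assignment is a function $f\colon X\to\{0,1\}$. An NNF $C$ is a finite directed acyclic graph whose nodes (gates) are labelled and whose arcs are called wires, with a unique sink (the output gate); source nodes (input gates) are labelled by $0$, $1$, $x$ or $\neg x$ with $x\in X$, non-source nodes by $\wedge$ or $\vee$. $\mathsf{vars}(C)$ is the set of variables occurring in input-gate labels; $\mathsf{size}(C)$ is the number of wires; two NNFs are equivalent if they take the same value under every assignment. For a gate $v$, $\mathsf{sub}(C,v)$ is the NNF consisting of $v$ and all gates with a directed path to $v$. A DNNF is an NNF in which, for every $\wedge$-gate with input wires from $v_1,\dots,v_i$, the sets $\mathsf{vars}(\mathsf{sub}(D,v_j))$ are pairwise disjoint. A CNF is viewed as an NNF with one $\wedge$ output gate, one $\vee$-gate per clause, and wires from the literal input gates into the clause gates; so its size is $\sum_{\text{clauses }K}(|K|+1)$ (for a graph CNF, $\mathsf{size}(E)=3|E|$). $\mathsf{DNNF}(F)$ is the minimum size of a DNNF equivalent to the CNF $F$. For a graph $G=(V,E)$ with at least two vertices and no isolated vertices, the graph CNF of $G$ is $\bigwedge_{\{x,y\}\in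 E}(x\vee y)$ over variables $V$, identified with $E$. For $S\subseteq V$, $N_S=\{v\in V\setminus S : \exists u\in S,\ \{u,v\}\in E\}$; the degree of $v$ is $d(v)=|N_{\{v\}}|$ and the degree of $G$ is the maximum degree of its vertices. For $d\geq 3$ and $c>0$, $G$ is a $(c,d)$-expander if $G$ has degree $d$ and $|N_S|\geq c|S|$ for all $S\subseteq V$ with $|S|\leq |V|/2$. *)

(* Defs.v *)
From mathcomp Require Import all_boot all_order all_algebra.
From mathcomp Require Import finmap.
From mathcomp Require Import boolp reals exp.

Set Implicit Arguments.
Unset Strict Implicit.
Unset Printing Implicit Defensive.

Import Order.TTheory GRing.Theory Num.Theory.

Variant gate_label (X : Type) :=
  | Const of bool
  | Pos of X
  | Neg of X
  | And
  | Or.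

Arguments Const {X} _.
Arguments And {X}.
Arguments Or {X}.

Definition is_input X (l : gate_label X) : bool :=
  match l with And | Or => false | _ => true end.

Definition label_var X (l : gate_label X) : option X :=
  match l with Pos x | Neg x => Some x | _ => None end.

(* A labelled digraph with a distinguished gate; [is_nnf] below carries all the
   well-formedness conditions.  [wire] is a relation, so wires are not
   parallel; [wire g h] is directed from [g] to [h], towards the output. *)
Record circuit (X : countType) := Circuit {
  gate : finType;
  wire : rel gate;
  label : gate -> gate_label X;
  out : gate
}.

Section Circuits.
Variable X : countType.
Implicit Types (C D : circuit X) (f : X -> bool).

Definition acyclic C : Prop :=
  forall g h : gate C, wire g h -> ~~ connect (@wire _ C) h g.

Definition is_nnf C : Prop :=
  [/\ acyclic C,
      forall g : gate C, [forall h, ~~ wire g h] = (g == out C)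
    & forall g : gate C, [forall h, ~~ wire h g] = is_input (label g)].

Definition vars C : {fset X} :=
  [fset x in pmap (fun g : gate C => label_var (label g)) (enum (gate C))]%fset.

Definition csize C : nat := #|[set p : gate C * gate C | wire p.1 p.2]|.

Definition sub C (v : gate C) : circuit X :=
  @Circuit X {u : gate C | connect (@wire _ C) u v}
    (fun a b => wire (val a) (val b)) (fun a => label (val a))
    (exist _ v (connect0 _ v)).

Definition is_dnnf D : Prop :=
  is_nnf D /\
  forall g : gate D, label g = And ->
  forall u v : gate D, wire u g -> wire v g -> u != v ->
    [disjoint vars (sub u) & vars (sub v)]%fset.

(* [n] bounds the length of the paths explored; in an acyclic circuit [#|gate C|]
   is enough for every gate, see [gate_valE]. *)
Fixpoint eval_upto C f (n : nat) (g : gate C) : bool :=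
  if n isn't n'.+1 then false else
  match label g with
  | Const b => b
  | Pos x => f x
  | Neg x => ~~ f x
  | And => [forall h : gate C, wire h g ==> eval_upto f n' h]
  | Or => [exists h : gate C, wire h g && eval_upto f n' h]
  end.

Definition gate_val C f (g : gate C) : bool := eval_upto f #|gate C| g.

Definition eval C f : bool := gate_val f (out C).

Definition equivalent C D : Prop := forall f, eval C f = eval D f.

Lemma gate_valE C f : acyclic C -> forall g : gate C,
  gate_val f g =
  match label g with
  | Const b => b
  | Pos x => f x
  | Neg x => ~~ f x
  | And => [forall h : gate C, wire h g ==> gate_val f h]
  | Or => [exists h : gate C, wire h g && gate_val f h]
  end.
Proof.
move=> acC g.
pose below (g : gate C) := #|[set h | connect (@wire _ C) h g]|.
have belowS h k : wire h k -> below h < below k.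
  move=> whk; apply/proper_card/properP; split.
    apply/subsetP=> u; rewrite !inE => /connect_trans; apply.
    exact: connect1.
  by exists k; rewrite !inE ?connect0 ?(acC h k).
have below_gt0 h : 0 < below h by apply/card_gt0P; exists h; rewrite inE.
have stable n m h : below h <= n -> below h <= m ->
    eval_upto f n h = eval_upto f m h.
  elim: n m h => [|n IH] [|m] h;
    try by rewrite leqNgt below_gt0.
    by rewrite [below h <= 0]leqNgt below_gt0.
  move=> ln lm /=.
  have IH' k : wire k h -> eval_upto f n k = eval_upto f m k.
    by move=> /belowS lk; apply: IH; rewrite -ltnS (leq_trans lk).
  case: (label h) => //.
    by apply: eq_forallb => k; case: (boolP (wire k h)) => //= /IH' ->.
  by apply: eq_existsb => k; case: (boolP (wire k h)) => //= /IH' ->.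
rewrite {1}/gate_val (@stable _ #|gate C|.+1) //; last by rewrite ltnW // ltnS max_card.
exact: max_card.
Qed.

Lemma eval_upto_vars C f f' n (g : gate C) :
  {in vars C, f =1 f'} -> eval_upto f n g = eval_upto f' n g.
Proof.
move=> eff; elim: n g => //= n IH g.
have ev x : label_var (label g) = Some x -> f x = f' x.
  move=> lx; apply: eff; rewrite inE /= mem_pmap -lx.
  by apply: map_f; rewrite mem_enum.
case: (label g) ev => [b|x|x||] //= ev; rewrite ?ev //.
  by apply: eq_forallb => k; rewrite IH.
by apply: eq_existsb => k; rewrite IH.
Qed.

(* The disjunctive normal form given by the truth table of [C]. *)
Section TruthTable.
Variable C : circuit X.

Let row : finType := {ffun vars C -> bool}.

Let ext (m : row) (x : X) : bool := if insub x is Some v then m v else false.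

Let tt_gate : finType := option (row + row * option (vars C))%type.

Let tt_wire (a b : tt_gate) : bool :=
  match a, b with
  | Some (inl _), None => true
  | Some (inr (m, _)), Some (inl m') => m == m'
  | _, _ => false
  end.

Let tt_label (a : tt_gate) : gate_label X :=
  match a with
  | None => Or
  | Some (inl _) => And
  | Some (inr (m, None)) => Const (eval C (ext m))
  | Some (inr (m, Some v)) => if m v then Pos (val v) else Neg (val v)
  end.

Let tt := @Circuit X tt_gate tt_wire tt_label None.

Lemma exists_dnnf : exists D : circuit X, is_dnnf D /\ equivalent D C.
Proof.
pose rank (a : tt_gate) :=
  match a with None => 2 | Some (inl _) => 1 | _ => 0 end.
have rankS a b : tt_wire a b -> rank a < rank b.
  by case: a b => [[m|[m o]]|] [[m'|[m' o']]|].
have rank_connect (a b : gate tt) : connect (@wire _ tt) a b -> rank a <= rank b.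
  case/connectP=> p; elim: p a => [|k p IH] a /=; first by move=> _ ->.
  by case/andP=> /rankS/ltnW lk /IH{}IH /IH; apply: leq_trans.
have actt : acyclic tt.
  move=> a b /rankS lab; apply/negP=> /rank_connect; rewrite leqNgt.
  by move/negP; apply.
have src (a b : gate tt) : rank b = 0 -> connect (@wire _ tt) a b -> a = b.
  move=> rb; case/connectP=> p; case/lastP: p => [//|p k].
  rewrite rcons_path last_rcons => /andP[_ /rankS lk] bk.
  by move: lk; rewrite -bk rb.
exists tt; split; first (split; first split) => //.
- move=> [[m|[m o]]|] /=.
  + by apply/forallP=> /(_ None).
  + by apply/forallP=> /(_ (Some (inl m))); rewrite /= eqxx.
  + by apply/forallP.
- move=> [[m|[m o]]|] /=.
  + by apply/forallP=> /(_ (Some (inr (m, None)))); rewrite /= eqxx.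
  + by case: o => [v|] /=; [case: ifP => _|]; apply/forallP=> -[[?|[? ?]]|].
  + by apply/forallP=> /(_ (Some (inl [ffun=> false]))).
- have subv m o x : x \in vars (@sub tt (Some (inr (m, o)))) ->
      omap val o = Some x.
    rewrite inE /= mem_pmap => /mapP[[a /= ca] _].
    rewrite (src _ _ _ ca) //=; case: o {ca} => [v|] //=.
    by case: (m v) => -[->].
  move=> [[m|[m o]]|] //=; last by case: o => // v; case: (m v).
  move=> _ [[?|[m1 o1]]|] [[?|[m2 o2]]|] //= /eqP-> /eqP-> no.
  apply/fdisjointP=> x /subv e1; apply/negP=> /subv e2.
  move/eqP: no; apply; congr (Some (inr (_, _))).
  case: o1 o2 e1 e2 => [v1|] [v2|] //= [e1] [e2].
  by congr Some; apply: val_inj; rewrite /= e1 e2.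
- move=> f; pose m0 : row := [ffun v => f (val v)].
  have ext0 : {in vars C, ext m0 =1 f}.
    by move=> x xV; rewrite /ext insubT ffunE.
  have evC : eval C (ext m0) = eval C f by exact: eval_upto_vars.
  rewrite /eval (gate_valE _ actt) /=.
  have andE (m : row) :
      gate_val f (Some (inl m) : gate tt) = (m == m0) && eval C f.
    rewrite (gate_valE _ actt) /=; apply/forallP/andP.
      move=> H; have em : m = m0.
        apply/ffunP=> v; rewrite ffunE.
        have := H (Some (inr (m, Some v))); rewrite /= eqxx /=.
        by rewrite (gate_valE _ actt) /=; case: (m v) => // /negbTE.
      split; first exact/eqP.
      have := H (Some (inr (m, None))); rewrite /= eqxx /=.
      by rewrite (gate_valE _ actt) /= em evC.
    move=> [/eqP-> Cf] [[?|[m1 o]]|] //=; apply/implyP=> /eqP->.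
    rewrite (gate_valE _ actt) /=; case: o => [v|] /=; last by rewrite evC.
    by rewrite ffunE; case: ifP => //= ->.
  apply/existsP/idP.
    by case=> -[[m|[? ?]]|] //=; rewrite andE => /andP[].
  by move=> Cf; exists (Some (inl m0)); rewrite /= andE eqxx.
Qed.

End TruthTable.

Lemma exists_dnnf_size C :
  exists n, `[< exists D, [/\ is_dnnf D, equivalent D C & csize D = n] >].
Proof.
have [D [dD eD]] := exists_dnnf C.
by exists (csize D); apply/asboolP; exists D.
Qed.

Definition dnnf_size C : nat := ex_minn (exists_dnnf_size C).

(* A literal is a variable together with its polarity ([true] for [x], [false]
   for its negation). *)
Definition literal : choiceType := (X * bool)%type.

Definition cnf := {fset {fset literal}}.

Definition literals (F : cnf) : {fset literal} := (\bigcup_(K <- F) K)%fset.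

Definition lit_label (l : literal) : gate_label X :=
  if l.2 then Pos l.1 else Neg l.1.

(* The gates are the output [None], one gate [inl K] per clause [K] and one
   input gate [inr l] per literal [l] that occurs in the formula. *)
Definition cnf_circuit (F : cnf) : circuit X :=
  @Circuit X (option (F + literals F)%type)
    (fun a b => match a, b with
                | Some (inr l), Some (inl K) => val l \in val K
                | Some (inl _), None => true
                | _, _ => false
                end)
    (fun a => match a with
              | None => And
              | Some (inl _) => Or
              | Some (inr l) => lit_label (val l)
              end)
    None.

End Circuits.

(* A finite simple graph whose vertices are variables. *)
Record sgraph (X : countType) := SGraph {
  vertices : {fset X};
  adj : rel vertices;
  adj_sym : symmetric adj;
  adj_irrefl : irreflexive adj
}.

Section Graphs.
Variables (X : countType) (G : sgraph X).
Implicit Type S : {set vertices G}.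

Definition nbhd S : {set vertices G} :=
  [set v in ~: S | [exists u in S, adj u v]].

Definition degree (v : vertices G) : nat := #|nbhd [set v]|.

Definition graph_degree : nat := \max_(v : vertices G) degree v.

Definition edge_clause (x y : vertices G) : {fset literal X} :=
  [fset (val x, true); (val y, true)]%fset.

Definition graph_cnf : cnf X :=
  [fset edge_clause p.1 p.2 | p : vertices G * vertices G & adj p.1 p.2]%fset.

End Graphs.

Local Open Scope ring_scope.

Definition expander (R : realType) (X : countType) (c : R) (d : nat)
    (G : sgraph X) : Prop :=
  graph_degree G = d /\
  forall S : {set vertices G},
    #|S|%:R <= #|` vertices G|%:R / 2 :> R -> c * #|S|%:R <= #|nbhd S|%:R.

Definition log2 (R : realType) (x : R) : R := ln x / ln 2.

Definition f_deg (R : realType) (d : nat) : R := log2 (1 + 2 ^- d).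

Definition g_exp (R : realType) (c : R) (d : nat) : R :=
  c * f_deg R d / (6 * d%:R ^+ 3).

(* Main.v *)
(* Say that a model of a DNNF uses a gate if it makes all gates true on some path
   from that gate to the output.  Two models using the same gate [p] can be
   mixed: take the first on the variables below a set of children of [p] and the
   second elsewhere.  Walking down from the output as long as few vertices lie
   outside the current subcircuit, every model of the graph CNF is seen to use a
   wire whose mixing set [Y] has at least [t ~ |E| / (2 d^2)] vertices on both
   sides; vertex covers being large (at least [|E| / d]) replaces smoothness at
   the [Or] gates.  Mixing models served by one wire forces an endpoint of each
   edge leaving [Y] to be true in all of them, hence by expansion at least
   [c t / d] common vertices are forced.  Forcing [k] vertices leaves at most a
   fraction [(1 + 2^-d)^-k] of all vertex covers, so at least
   [(1 + 2^-d)^(c |E| / (2 d^3))] wires are needed. *)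
Require Import Defs.
From mathcomp Require Import all_boot all_order all_algebra.
From mathcomp Require Import finmap zify ring.
From mathcomp Require Import boolp reals exp.

Set Implicit Arguments.
Unset Strict Implicit.
Unset Printing Implicit Defensive.

Import Order.TTheory GRing.Theory Num.Theory.

(** * Variables and values below a gate *)

Section CircuitVars.
Variables (X : countType) (C : circuit X).
Implicit Types (f : X -> bool) (g h : gate C).

Lemma vars_subP g x :
  reflect (exists2 u, connect (@wire _ C) u g & label_var (label u) = Some x)
          (x \in vars (sub g)).
Proof.
rewrite inE /= mem_pmap; apply: (iffP mapP) => [[u _ e]|[u cu e]].
  by exists (val u); [exact: valP u | rewrite -e].
by exists (exist _ u cu); rewrite ?mem_enum.
Qed.

Lemma vars_sub_wire h g : wire h g -> {subset vars (sub h) <= vars (sub g)}.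
Proof.
move=> whg x /vars_subP[u cu e]; apply/vars_subP; exists u => //.
exact: connect_trans cu (connect1 whg).
Qed.

Lemma gate_val_vars f f' g :
  {in vars (sub g), f =1 f'} -> gate_val f g = gate_val f' g.
Proof.
rewrite /gate_val; elim: #|gate C| g => //= n IH g eff.
have ev x : label_var (label g) = Some x -> f x = f' x.
  by move=> lx; apply: eff; apply/vars_subP; exists g; rewrite ?connect0.
have eh h : wire h g -> eval_upto f n h = eval_upto f' n h.
  by move=> whg; apply: IH => x /(vars_sub_wire whg); apply: eff.
case: (label g) ev => [b|x|x||] //= ev; rewrite ?ev //.
  by apply: eq_forallb => h; case: (boolP (wire h g)) => //= /eh ->.
by apply: eq_existsb => h; case: (boolP (wire h g)) => //= /eh ->.
Qed.

Lemma acyclic_rank (rank : gate C -> nat) :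
  (forall g h, wire g h -> rank g < rank h) -> acyclic C.
Proof.
move=> rankS g h /rankS lgh; apply/negP => /connectP[p].
elim: p h lgh => [|k p IH] h lgh /=; first by move=> _ e; rewrite e ltnn in lgh.
by case/andP=> /rankS lk; apply: IH; apply: ltn_trans lk.
Qed.

End CircuitVars.

(** * Mixing two models at a gate of a DNNF *)

Definition mix (X : Type) (Y : pred X) (f f' : X -> bool) : X -> bool :=
  fun x => if Y x then f x else f' x.

(** Variables that name no vertex keep their value, so only vertices outside [S] are switched
    off. *)
Definition restrict_to (X : eqType) (V : finType) (name : V -> X) (S : {set V})
    (f : X -> bool) : X -> bool :=
  fun x => f x && [forall v, (name v == x) ==> (v \in S)].

Section Rectangles.
Variables (X : countType) (D : circuit X).
Hypothesis dnnfD : is_dnnf D.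
Implicit Types (f : X -> bool) (g h p : gate D) (K : {set gate D}).

Let acD : acyclic D. Proof. by case: dnnfD => -[]. Qed.

Lemma dnnf_disjoint g h k x : label g = And -> wire h g -> wire k g ->
  x \in vars (sub h) -> x \in vars (sub k) -> h = k.
Proof.
move=> lg wh wk xh xk; apply/eqP/negPn/negP => nhk.
have /fdisjointP/(_ x xh) := dnnfD.2 g lg h k wh wk nhk.
by rewrite xk.
Qed.

Lemma wire_not_input h g : wire h g -> ~~ is_input (label g).
Proof.
move=> whg; case: dnnfD => -[_ _ /(_ g) <-] _.
by apply/forallP => /(_ h); rewrite whg.
Qed.

Definition true_wire f : rel (gate D) := fun g h => wire g h && gate_val f h.

(* [f] and [f'] may differ below [p] only: whatever meets the path above [p] at
   an [And] gate has its variables outside [vars (sub p)]. *)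
Lemma eval_above f f' p :
  connect (true_wire f) p (out D) -> gate_val f' p ->
  (forall x, x \notin vars (sub p) -> f' x = f x) -> eval D f'.
Proof.
case/connectP => s; elim: s p => [|q s IH] p /=.
  by move=> _ e vp _; rewrite /eval e.
case/andP=> /andP[wpq vq] pth lst vp ff; apply: (IH q) => //; last first.
  by move=> x xq; apply: ff; apply: contra xq; apply: vars_sub_wire.
have := wire_not_input wpq; move: vq.
rewrite !gate_valE //; case lq: (label q) => // vq _.
  apply/forallP => k; apply/implyP => wkq.
  have [->//|npk] := eqVneq k p.
  have /implyP/(_ wkq) := forallP vq k.
  rewrite (@gate_val_vars _ _ f f') // => x xk; rewrite ff //.
  by apply: contra_neqN npk => xp; apply: (dnnf_disjoint lq wkq wpq xk xp).
by apply/existsP; exists p; rewrite wpq.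
Qed.

Definition vars_of K : pred X := fun x => [exists k in K, x \in vars (sub k)].

Lemma vars_ofP K x :
  reflect (exists2 k, k \in K & x \in vars (sub k)) (vars_of K x).
Proof. exact: exists_inP. Qed.

(** At an [And] gate, the children outside [K] share no variable with those in [K], so they keep
    their value under [f']. At an [Or] gate one true child is enough, and a singleton [K] provides
    it. Above [p] nothing changes, by [eval_above]. *)
Lemma eval_mix f f' p K :
  (label p = And \/ exists k, K = [set k]) ->
  K \subset [set k | wire k p] -> [forall k in K, gate_val f k] ->
  connect (true_wire f') p (out D) -> gate_val f' p ->
  eval D (mix (vars_of K) f f').
Proof.
move=> KP /subsetP KW Kt cp vp; apply: (eval_above cp); last first.
  move=> x; rewrite /mix; case: ifP => // /vars_ofP[k kK xk].
  by move: (KW k kK); rewrite inE => /vars_sub_wire -> .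
have vK k : k \in K -> gate_val (mix (vars_of K) f f') k.
  move=> kK; rewrite (@gate_val_vars _ _ _ f).
    exact: (implyP (forallP Kt k)).
  move=> x xk; rewrite /mix ifT //; by apply/vars_ofP; exists k.
have np : ~~ is_input (label p).
  case: KP => [->//|[k0 eK]]; apply: (@wire_not_input k0).
  by have := KW k0; rewrite eK !inE eqxx => ->.
move: KP vp np; rewrite !gate_valE //; case ep: (label p) => // KP vp np.
- apply/forallP => k; apply/implyP => wk.
  case: (boolP (k \in K)) => [/vK//|nkK].
  have := implyP (forallP vp k) wk.
  rewrite (@gate_val_vars _ _ f' (mix (vars_of K) f f')) // => x xk.
  rewrite /mix ifF //; apply/negbTE/negP => /vars_ofP[k' k'K xk'].
  have := KW _ k'K; rewrite inE => wk'.
  by move: nkK; rewrite (dnnf_disjoint ep wk wk' xk xk') k'K.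
- case: KP => // -[k eK]; apply/existsP; exists k; rewrite vK ?eK ?inE ?eqxx // andbT.
  by have := KW k; rewrite eK !inE eqxx => ->.
Qed.

(** * Balanced cuts and the models served by a wire *)

Variables (V : finType) (name : V -> X) (t : nat).
Hypothesis name_inj : injective name.

Definition vset K : {set V} := [set v | vars_of K (name v)].

Definition balanced K : bool := (t <= #|vset K|) && (t <= #|~: vset K|).

(* The split of an [And] gate must not depend on the model, so that each wire
   accounts for a single rectangle. *)
Definition and_split p : {set gate D} :=
  odflt set0 [pick K : {set gate D} | (K \subset [set k | wire k p]) && balanced K].

Definition cut (w : gate D * gate D) : {set gate D} :=
  if label w.2 is And then and_split w.2 else [set w.1].

Definition served f (w : gate D * gate D) : bool :=
  [&& wire w.1 w.2, connect (true_wire f) w.2 (out D), gate_val f w.2,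
      gate_val f w.1 & balanced (cut w)].

Lemma and_split_sub p : and_split p \subset [set k | wire k p].
Proof. by rewrite /and_split; case: pickP => [K /andP[]|] //=; rewrite sub0set. Qed.

Lemma served_mix f f' w :
  served f w -> served f' w -> eval D (mix (vars_of (cut w)) f f').
Proof.
case: w => h p; case/and5P => /= whp _ vp vh _ /and5P[_ cp vp' _ _].
have ip := wire_not_input whp.
apply: (@eval_mix _ _ p) => //; rewrite /cut /=;
  move: ip; case ep: (label p) => // _.
- by left.
- by right; exists h.
- exact: and_split_sub.
- by apply/subsetP => k; rewrite !inE => /eqP ->.
- apply/forallP => k; apply/implyP => /(subsetP (and_split_sub p)).
  rewrite inE => wk; move: vp; rewrite gate_valE // ep => /forallP/(_ k).
  by rewrite wk.
- by apply/forallP => k; apply/implyP; rewrite inE => /eqP ->.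
Qed.

Lemma vset1 g : vset [set g] = [set v | name v \in vars (sub g)].
Proof.
apply/setP => v; rewrite !in_set; apply/vars_ofP/idP => [[k]|vg].
  by rewrite in_set1 => /eqP ->.
by exists g; rewrite ?in_set1.
Qed.

Lemma vsetU K K' : vset (K :|: K') = vset K :|: vset K'.
Proof.
apply/setP => v; rewrite !in_set; apply/vars_ofP/orP.
  by case=> k; rewrite in_set => /orP[] kK xk; [left|right]; apply/vars_ofP; exists k.
by case=> /vars_ofP[k kK xk]; exists k; rewrite // inE kK ?orbT.
Qed.

Lemma vset0 : vset set0 = set0.
Proof. by apply/setP => v; rewrite !in_set; apply/vars_ofP => -[k]; rewrite in_set. Qed.

(** A gate that is not an input carries no variable itself, and a nontrivial path into [g] ends with
    a wire from a child. *)
Lemma vset_children g : ~~ is_input (label g) ->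
  vset [set g] \subset vset [set k | wire k g].
Proof.
move=> ng; rewrite vset1; apply/subsetP => v; rewrite !in_set => /vars_subP[u].
case/connectP => s; case/lastP: s => [|s k] /=.
  by move=> _ <- e; case: (label g) ng e.
rewrite rcons_path last_rcons => /andP[ps wk] gk e; subst k.
apply/vars_ofP; exists (last u s); first by rewrite in_set.
apply/vars_subP; exists u => //.
by apply/connectP; exists s.
Qed.

Lemma card_vset_input g : is_input (label g) -> #|vset [set g]| <= 1.
Proof.
move=> ig; have nw k : ~~ wire k g.
  by apply/negP => /wire_not_input; rewrite ig.
have lab (v : V) : v \in vset [set g] -> label_var (label g) = Some (name v).
  rewrite vset1 in_set => /vars_subP[u /connectP[s]].
  case/lastP: s => [_ -> //|s k].
  rewrite rcons_path last_rcons => /andP[_ wk] e; subst k.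
  by move: (nw (last u s)); rewrite wk.
by apply/card_le1_eqP => u v /lab eu /lab; rewrite eu => -[] /name_inj.
Qed.

(** If one child has [t] vertices, it is balanced alone. Otherwise a minimal set of children with at
    least [t] vertices has at most [2 * t - 2]: fewer than [t] from one child and, by minimality,
    fewer than [t] from the rest. This leaves at least [t] outside as [3 * t <= #|V| + 2]. *)
Lemma balanced_children p : 3 * t <= #|V| + 2 ->
  t <= #|vset [set k | wire k p]| ->
  (forall k, wire k p -> t <= #|~: vset [set k]|) -> 0 < t ->
  exists K, (K \subset [set k | wire k p]) && balanced K.
Proof.
move=> tn tp tk t0.
pose Q := [pred K : {set gate D} | t <= #|vset K|].
have [K /minsetP[/= tK minK] KW] : {K | minset Q K & K \subset [set k | wire k p]}.
  exact: minset_exists.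
have [K0|[k kK]] := set_0Vmem K.
  by move: tK; rewrite K0 vset0 cards0 leqNgt t0.
have wk : wire k p by have := subsetP KW k kK; rewrite in_set.
have [tk1|tk1] := leqP t #|vset [set k]|.
  exists [set k]; rewrite /balanced tk1 tk // !andbT.
  by apply/subsetP => j; rewrite in_set1 in_set => /eqP ->.
exists K; rewrite KW /balanced tK /=.
have lt : #|vset (K :\ k)| < t.
  rewrite ltnNge; apply/negP => /minK; rewrite subD1set => /(_ isT) e.
  by have := setD11 k K; rewrite e kK.
have := cardsC (vset K).
have : #|vset K| <= #|vset [set k]| + #|vset (K :\ k)|.
  by rewrite -{1}(setD1K kK) vsetU leq_card_setU.
by lia.
Qed.

Lemma exists_served f :
  1 < #|V| -> 3 * t <= #|V| + 2 ->
  (forall S : {set V}, eval D (restrict_to name S f) -> 2 * t <= #|S| + 1) ->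
  #|~: vset [set out D]| < t -> eval D f ->
  exists w, served f w.
Proof.
move=> n2 tn model_size small_out ev.
pose below (g : gate D) := #|[set h | connect (@wire _ D) h g]|.
have belowS h k : wire h k -> below h < below k.
  move=> whk; apply/proper_card/properP; split.
    apply/subsetP=> u; rewrite !in_set => /connect_trans; apply.
    exact: connect1.
  by exists k; rewrite !in_set ?connect0 ?(acD whk).
(* The invariant is that fewer than [t] vertices lie outside the current gate; the number of gates
   below it decreases. *)
have descend : forall m g, below g < m -> connect (true_wire f) g (out D) ->
    gate_val f g -> #|~: vset [set g]| < t -> exists w, served f w.
  elim=> // m IH g ltg cg vg sg.
  have IHk k : wire k g -> gate_val f k -> #|~: vset [set k]| < t ->
      exists w, served f w.
    move=> wk vk; apply: IH => //; first exact: leq_trans (belowS _ _ wk) _.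
    by apply: connect_trans cg; apply: connect1; rewrite /true_wire wk.
  case: (boolP (is_input (label g))) => [ig|ng].
    (* An input gate has at most one vertex, which would give [#|V| <= t], against
       [3 * t <= #|V| + 2] and [1 < #|V|]. *)
    by have := card_vset_input ig; have := cardsC (vset [set g]); lia.
  case lg: (label g) ng => // ng.
  - case: (boolP [exists k, wire k g && (#|~: vset [set k]| < t)]).
      case/existsP => k /andP[wk]; apply: IHk => //.
      by move: vg; rewrite gate_valE // lg => /forallP/(_ k); rewrite wk.
    rewrite negb_exists => /forallP big.
    have {}big k : wire k g -> t <= #|~: vset [set k]|.
      by move=> wk; have := big k; rewrite wk -leqNgt.
    have [||K KP] := @balanced_children g tn _ big; last first.
    + have bs : balanced (and_split g).
        rewrite /and_split; case: pickP => [? /andP[]//|/(_ K)].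
        by rewrite KP.
      (* Any wire into [g] will do, since the cut at an [And] gate depends on the gate alone. *)
      have [h wh] : exists h, wire h g.
        case: dnnfD => -[_ _ /(_ g)]; rewrite lg /= => /negbT.
        by rewrite negb_forall => /existsP[h]; rewrite negbK; exists h.
      exists (h, g); rewrite /served /cut /= lg wh cg vg bs andbT /=.
      by move: vg; rewrite gate_valE // lg => /forallP/(_ h); rewrite wh.
    + exact: leq_ltn_trans sg.
    + have /vset_children/subset_leq_card : ~~ is_input (label g) by rewrite lg.
      by have := cardsC (vset [set g]); lia.
  - have := vg; rewrite gate_valE // lg => /existsP[h /andP[wh vh]].
    have [|bh] := ltnP #|~: vset [set h]| t; first exact: IHk.
    exists (h, g); rewrite /served /cut /= lg wh cg vg vh /balanced bh andbT /=.
    (* Switching off the vertices below [g] but not below [h] keeps [h], hence [g] and the output,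
       true. So [S] has at least [2 * t - 1] vertices, of which fewer than [t] lie outside [g]; the
       others are below [h]. *)
    pose S := vset [set h] :|: ~: vset [set g].
    have : 2 * t <= #|S| + 1.
      apply: model_size; apply: (eval_above cg).
        rewrite gate_valE // lg; apply/existsP; exists h; rewrite wh /=.
        rewrite (@gate_val_vars _ _ _ f) // => x xh.
        rewrite /restrict_to [X in _ && X](_ : _ = true) ?andbT //.
        by apply/forallP => v; apply/implyP => /eqP vx;
          rewrite in_setU vset1 in_set vx xh.
      move=> x xg; rewrite /restrict_to [X in _ && X](_ : _ = true) ?andbT //.
      by apply/forallP => v; apply/implyP => /eqP vx;
        rewrite in_setU in_setC !vset1 !in_set vx xg orbT.
    have := (leq_card_setU (vset [set h]) (~: vset [set g])).1.
    by rewrite -/S; lia.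
apply: (descend (below (out D)).+1) => //.
Qed.

End Rectangles.

(** * Counting vertex covers that contain a given set *)

Section VertexCovers.
Variables (T : finType) (e : rel T).
Hypotheses (e_sym : symmetric e) (e_irr : irreflexive e).
Implicit Types (S W : {set T}) (u v x y : T).

Definition is_cover S : bool :=
  [forall x, forall y, e x y ==> (x \in S) || (y \in S)].

Lemma is_coverP S :
  reflect (forall x y, e x y -> (x \in S) || (y \in S)) (is_cover S).
Proof.
apply: (iffP forallP) => [H x y exy|H x].
  by have /forallP/(_ y)/implyP := H x; apply.
by apply/forallP => y; apply/implyP/H.
Qed.

Definition covers_above W : {set {set T}} := [set S | is_cover S & W \subset S].

(** A cover [S] containing [v] becomes one without [v] on adding the neighbours of [v] and deleting
    [v]. Remembering which neighbours were already in [S] makes this injective, whence the power of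
    2. *)
Lemma covers_aboveD1 W v : v \notin W ->
  #|covers_above (v |: W)| <=
    2 ^ #|[set u | e v u]| * #|[set S in covers_above W | v \notin S]|.
Proof.
move=> vW; set N := [set u | e v u].
pose phi S := ((S :|: N) :\ v, S :&: N).
have phi_inj : {in covers_above (v |: W) &, injective phi}.
  move=> S S'; rewrite !inE !subUset !sub1set.
  move=> /andP[_ /andP[vS _]] /andP[_ /andP[vS' _]] [/setP e1 /setP e2].
  apply/setP => x; have := e1 x; have := e2 x; rewrite !inE.
  have [->|_] := eqVneq x v; first by rewrite vS vS'.
  by case: (e v x); rewrite ?andbT ?orbF.
rewrite -(card_in_imset phi_inj) mulnC -card_powerset -cardsX.
apply/subset_leq_card/subsetP => _ /imsetP[S + ->].
rewrite !inE subUset sub1set => /andP[/is_coverP cS /andP[vS WS]].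
rewrite eqxx subsetIr andbT andbT; apply/andP; split.
  apply/is_coverP => x y exy; have := cS x y exy; rewrite !inE.
  have [xv|_] := eqVneq x v.
    by move: exy; rewrite xv; have [->|_ ->] := eqVneq y v; rewrite ?e_irr ?orbT.
  have [yv|_] := eqVneq y v; last by case/orP=> ->; rewrite ?orbT.
  by move: exy; rewrite yv e_sym => ->; rewrite orbT.
apply/subsetP => x xW; rewrite !inE (subsetP WS x xW) andbT.
by apply: contraNneq vW => <-.
Qed.

Lemma covers_above_split W v :
  #|covers_above W| =
    #|covers_above (v |: W)| + #|[set S in covers_above W | v \notin S]|.
Proof.
rewrite -(cardsID [set S : {set T} | v \in S] (covers_above W)).
congr (_ + _); apply: eq_card => S; rewrite !inE ?subUset ?sub1set.
  by rewrite -andbA [(_ \subset _) && _]andbC.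
by rewrite andbC.
Qed.

Local Open Scope ring_scope.

(** Vertices are removed from [W] one at a time. Of the covers above [W :\ v], let [a] contain [v]
    and [b] avoid it; then [a <= 2 ^ d * b], so [a * (1 + 2 ^- d) <= a + b]. *)
Lemma covers_above_ratio (R : realType) d W :
  (forall v, #|[set u | e v u]| <= d)%N ->
  #|covers_above W|%:R * (1 + 2 ^- d) ^+ #|W| <= #|covers_above set0|%:R :> R.
Proof.
move=> deg; have [n] := ubnP #|W|; elim: n W => // n IH W leW.
have [->|[v vW]] := set_0Vmem W; first by rewrite cards0 expr0 mulr1.
have vW' : v \notin W :\ v by rewrite setD11.
have := covers_above_split (W :\ v) v; have := covers_aboveD1 vW'.
rewrite setD1K // (cardsD1 v W) vW exprS => leB eqB.
rewrite (cardsD1 v W) vW in leW.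
apply: le_trans (IH (W :\ v) _) => //; rewrite mulrA ler_wpM2r //.
  by rewrite exprn_ge0 // addr_ge0 // invr_ge0 exprn_ge0.
have pd : 0 < 2 ^+ d :> R by rewrite exprn_gt0.
rewrite eqB natrD mulrDr mulr1 lerD2l ler_pdivrMr // -natrX -natrM ler_nat.
by rewrite (leq_trans leB) // mulnC leq_mul // leq_exp2l.
Qed.

End VertexCovers.

(** * Expansion across a cut *)

Local Open Scope ring_scope.

Definition outer_nbhd (T : finType) (e : rel T) (S : {set T}) : {set T} :=
  [set v in ~: S | [exists u in S, e u v]].

(* A set [W] meeting every edge between [Y] and its complement absorbs the
   neighbourhood of the smaller side. *)
Lemma cut_cover_card (R : realType) (T : finType) (e : rel T) (c : R) (d t : nat)
    (Y W : {set T}) :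
  symmetric e -> (0 < d)%N -> (forall v, #|[set u | e v u]| <= d)%N -> 0 < c ->
  (forall S : {set T}, (2 * #|S| <= #|T|)%N -> c * #|S|%:R <= #|outer_nbhd e S|%:R) ->
  (t <= #|Y|)%N -> (t <= #|~: Y|)%N ->
  (forall x y, x \in Y -> y \notin Y -> e x y -> (x \in W) || (y \in W)) ->
  c * t%:R <= (d * #|W|)%:R.
Proof.
move=> e_sym d0 deg c0 expa.
(* The condition on [W] is symmetric in [Y] and its complement, one of which has at most half of the
   vertices. *)
wlog small : Y / (2 * #|Y| <= #|T|)%N.
  move=> wl tY tC cutW; have [|lt] := leqP (2 * #|Y|) #|T|; first by move=> sm; exact: (wl Y).
  apply: (wl (~: Y)) => //; first by have := cardsC Y; lia.
    by rewrite setCK.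
  move=> x y; rewrite !inE negbK => xY yY exy.
  by rewrite orbC; apply: cutW => //; rewrite e_sym.
move=> tY _ cutW; apply: (@le_trans _ _ (c * #|Y|%:R)).
  by rewrite ler_pM2l // ler_nat.
apply: le_trans (expa Y small) _; rewrite ler_nat.
(* A neighbour of [Y] lies in [W] itself or is adjacent to a vertex of [W] inside [Y]; the former
   count once each, the latter at most [d] per vertex of [W :&: Y]. *)
have sub : outer_nbhd e Y \subset (W :\: Y) :|: \bigcup_(v in W :&: Y) [set u | e v u].
  apply/subsetP => y; rewrite !inE => /andP[yY /exists_inP[x xY exy]].
  have [xW|xW] := boolP (x \in W).
    by apply/orP; right; apply/bigcupP; exists x; rewrite !inE ?xW.
  by have := cutW x y xY yY exy; rewrite (negbTE xW) yY /= => ->.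
have le_bigcup : (#|\bigcup_(v in W :&: Y) [set u | e v u]| <= d * #|W :&: Y|)%N.
  apply: (@leq_trans (\sum_(v in W :&: Y) #|[set u | e v u]|)).
    elim/big_rec2: _ => [|v A n _ leA]; first by rewrite cards0.
    by rewrite (leq_trans (leq_card_setU _ _).1) // leq_add2l.
  by rewrite mulnC -sum_nat_const leq_sum.
have := (leq_card_setU (W :\: Y) (\bigcup_(v in W :&: Y) [set u | e v u])).1.
have := subset_leq_card sub; have := cardsID Y W; nia.
Qed.

(** * The lower bound on the number of wires *)

(** [m] will be the number of clauses; it enters only through its positivity and the lower bound
    [m / d] on the size of a cover. *)
Lemma dnnf_wires_lower_bound (R : realType) (X : countType) (D : circuit X)
    (T : finType) (name : T -> X) (e : rel T) (c : R) (d m : nat) :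
  is_dnnf D -> injective name -> symmetric e -> irreflexive e ->
  (3 <= d)%N -> (forall v, #|[set u | e v u]| <= d)%N -> 0 < c ->
  (forall S : {set T}, (2 * #|S| <= #|T|)%N -> c * #|S|%:R <= #|outer_nbhd e S|%:R) ->
  (1 < #|T|)%N -> (0 < m)%N ->
  (forall S : {set T}, is_cover e S -> (m <= d * #|S|)%N) ->
  (forall f, eval D f = is_cover e [set v | f (name v)]) ->
  (1 + 2 ^- d) `^ (c * m%:R / (2 * d%:R ^+ 3)) <= (csize D)%:R :> R.
Proof.
move=> dnnfD name_inj e_sym e_irr d3 deg c0 expa n2 m0 m_cover evD.
pose fS (S : {set T}) x := [exists v in S, name v == x].
have fSE S v : fS S (name v) = (v \in S).
  apply/exists_inP/idP => [[u uS /eqP/name_inj <-//]|vS].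
  by exists v.
have evS S : eval D (fS S) = is_cover e S.
  by rewrite evD; congr is_cover; apply/setP => v; rewrite inE fSE.
(* Rounding down gives [2 * d * q <= k], hence [6 * q <= k], whenever [m <= d * k]; this yields the
   upper bounds on [t]. The successor makes [t] positive and gives [m <= 2 * d ^ 2 * t], so the
   final exponent loses nothing. *)
pose q := (m %/ (2 * d ^ 2))%N; pose t := q.+1.
have qm : (2 * d ^ 2 * q <= m)%N by rewrite mulnC leq_trunc_div.
have mt : (m <= 2 * d ^ 2 * t)%N.
  by rewrite ltnW // mulnC ltn_ceil // muln_gt0 expn_gt0; lia.
have coverT : is_cover e setT by apply/is_coverP => x y _; rewrite inE.
have q_small (k : nat) : (m <= d * k)%N -> (6 * q <= k)%N.
  move=> mk; have : (d * (2 * d * q) <= d * k)%N.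
    by apply: leq_trans mk; move: qm; rewrite expnS expn1; nia.
  by rewrite leq_pmul2l; nia.
have tn : (3 * t <= #|T| + 2)%N.
  by have := q_small _ (m_cover _ coverT); rewrite cardsT /t; lia.
have cover_gt0 S : is_cover e S -> (0 < #|S|)%N.
  by move=> /m_cover; case: #|S| => //; rewrite muln0; lia.
have size_cover S : is_cover e S -> (2 * t <= #|S| + 1)%N.
  move=> cS; have := cover_gt0 S cS; have := q_small _ (m_cover _ cS).
  by rewrite /t; lia.
have small_out : (#|~: vset name [set out D]| < t)%N.
  suff -> : ~: vset name [set out D] = set0 by rewrite cards0.
  apply/setP => v; rewrite !in_set; apply/negbTE; rewrite negbK.
  (* Expansion of the singleton of [v] provides a neighbour. *)
  have [u euv] : exists u, e u v.
    have : 0 < #|outer_nbhd e [set v]|%:R :> R.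
      by apply: lt_le_trans (expa [set v] _); rewrite cards1 ?mulr1 //; lia.
    rewrite ltr0n => /card_gt0P[u]; rewrite inE => /andP[_ /exists_inP[w]].
    by rewrite inE => /eqP -> ewu; exists u; rewrite e_sym.
  apply/vars_ofP; exists (out D); first by rewrite in_set1.
  apply/negPn/negP => vout.
  have uv : u != v by apply: contraTneq euv => ->; rewrite e_irr.
  (* If [v] did not occur in [D], then [D] could not distinguish the complement of [u], a cover,
     from the complement of [u] and [v], which misses the edge between them. *)
  have : eval D (fS [set~ u]) = eval D (fS (~: [set u; v])).
    apply: gate_val_vars => x xout; apply/exists_inP/exists_inP;
      case=> w wS /eqP wx; exists w; rewrite ?wx //; move: wS; rewrite !inE.
      by move=> nwu; rewrite negb_or nwu; apply: contraNneq vout => <-; rewrite wx.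
    by rewrite negb_or => /andP[].
  rewrite !evS (_ : is_cover e [set~ u]); last first.
    apply/is_coverP => x y exy; rewrite !inE -negb_and.
    by apply: contraL exy => /andP[/eqP -> /eqP ->]; rewrite e_irr.
  by move/esym/is_coverP/(_ _ _ euv); rewrite !inE !eqxx orbT.
pose P (w : gate D * gate D) (S : {set T}) := is_cover e S && served name t (fS S) w.
pose wires := [set p : gate D * gate D | wire p.1 p.2].
have cover_served (S : {set T}) : is_cover e S -> exists2 w, w \in wires & P w S.
  move=> cS; have [||w sw] := @exists_served _ _ dnnfD _ _ t name_inj (fS S) n2 tn _ small_out.
  - move=> S'; rewrite evD => cS'; apply: size_cover.
    apply/is_coverP => x y /(is_coverP _ _ cS').
    by rewrite !inE => /orP[] /andP[_ /forallP H]; apply/orP; [left|right];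
      apply: (implyP (H _)).
  - by rewrite evS.
  - by exists w; rewrite /P ?cS // inE; case/and5P: sw.
pose forced (w : gate D * gate D) : {set T} := [set v | [forall S, P w S ==> (v \in S)]].
set r := _ `^ _.
have r_forced w S0 : P w S0 -> r <= (1 + 2 ^- d) ^+ #|forced w|.
  move=> PS0; have b1 : 1 <= 1 + 2 ^- d :> R by rewrite lerDl invr_ge0 exprn_ge0.
  rewrite -powR_mulrn ?(le_trans ler01) // /r ler_powR //.
  pose Y := vset name (cut name t w).
  (* Being served includes that the cut is balanced, so a single cover [S0] served by [w] is enough
     here. *)
  have [tY tYC] : (t <= #|Y|)%N /\ (t <= #|~: Y|)%N.
    by case/andP: PS0 => _ /and5P[_ _ _ _ /andP[]].
  have := @cut_cover_card R T e c d t Y (forced w) e_sym _ deg c0 expa tY tYC.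
  move=> le_ct; have {le_ct} : c * t%:R <= (d * #|forced w|)%:R.
    apply: le_ct; first by lia.
    (* If neither end is forced, some served [S] avoids [x] and some served [S'] avoids [y]. Taking
       [S] on [Y] and [S'] elsewhere would give a cover missing the edge. *)
    move=> x y xY yY exy; apply/negPn/negP; rewrite negb_or !inE !negb_forall.
    case/andP=> /existsP[S]; rewrite negb_imply => /andP[/andP[_ sS] xS].
    case/existsP=> S'; rewrite negb_imply => /andP[/andP[_ sS'] yS'].
    have := served_mix dnnfD sS sS'; rewrite evD => /is_coverP/(_ _ _ exy).
    move: xY yY; rewrite !in_set /mix => -> /negbTE ->.
    by rewrite !fSE (negbTE xS) (negbTE yS').
  have d0 : 0 < d%:R :> R by rewrite ltr0n; lia.
  move=> le_ct; rewrite ler_pdivrMr ?mulr_gt0 ?exprn_gt0 //.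
  (* The chain is [c * m <= 2 * d ^ 2 * (c * t) <= 2 * d ^ 3 * #|forced w|]. *)
  apply: (@le_trans _ _ (c * (2 * d ^ 2 * t)%:R)); first by rewrite ler_pM2l // ler_nat.
  rewrite natrM in le_ct.
  have -> : c * (2 * d ^ 2 * t)%:R = c * t%:R * (2 * d%:R ^+ 2) by rewrite !natrM; ring.
  have -> : #|forced w|%:R * (2 * d%:R ^+ 3) = d%:R * #|forced w|%:R * (2 * d%:R ^+ 2) :> R by ring.
  by rewrite ler_wpM2r // mulr_ge0 // exprn_ge0 // ltW.
pose M := covers_above e set0.
(* A wire serves at most a fraction [1 / r] of all covers; a wire serving none has no [S0] and is
   treated apart. *)
have block w : #|[set S | P w S]|%:R * r <= #|M|%:R.
  have [->|[S0]] := set_0Vmem [set S | P w S]; first by rewrite cards0 mul0r.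
  rewrite inE => /r_forced lr.
  apply: le_trans (@covers_above_ratio _ _ e_sym e_irr R _ (forced w) deg).
  apply: ler_pM => //; first exact: powR_ge0.
  rewrite ler_nat; apply/subset_leq_card/subsetP => S; rewrite !inE => PS.
  case/andP: (PS) => -> _ /=; apply/subsetP => v; rewrite inE.
  by move=> /forallP/(_ S); rewrite PS.
have M0 : 0 < #|M|%:R :> R.
  by rewrite ltr0n; apply/card_gt0P; exists setT; rewrite inE coverT sub0set.
have leM : (#|M| <= \sum_(w in wires) #|[set S | P w S]|)%N.
  apply: (@leq_trans #|\bigcup_(w in wires) [set S | P w S]|).
    apply/subset_leq_card/subsetP => S; rewrite inE => /andP[/cover_served[w ww PS] _].
    by apply/bigcupP; exists w => //; rewrite inE.
  elim/big_rec2: _ => [|w k A _ leA]; first by rewrite cards0.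
  by rewrite (leq_trans (leq_card_setU _ _).1) // leq_add2l.
(* Summing [block] over the wires bounds [#|M| * r] by [#|M|] times their number. *)
rewrite -(ler_pM2l M0); apply: (@le_trans _ _ (\sum_(w in wires) #|[set S | P w S]|%:R * r)).
  rewrite -mulr_suml -natr_sum ler_wpM2r ?powR_ge0 //.
  by rewrite ler_nat.
apply: (@le_trans _ _ (\sum_(w in wires) #|M|%:R)); first exact: ler_sum.
by rewrite sumr_const mulr_natr.
Qed.

(** * The graph CNF: clauses, size and models *)

Section GraphCNF.
Variables (X : countType) (G : sgraph X).
Local Open Scope nat_scope.

Lemma mem_nbhd1 (v u : vertices G) : (u \in nbhd [set v]) = adj v u.
Proof.
rewrite !inE; apply/andP/idP => [[_ /exists_inP[w]]|avu].
  by rewrite inE => /eqP ->.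
split; first by apply: contraTneq avu => ->; rewrite adj_irrefl.
by apply/exists_inP; exists v; rewrite ?inE.
Qed.

Lemma mem_graph_cnf K :
  reflect (exists x y : vertices G, adj x y /\ K = edge_clause x y)
          (K \in graph_cnf G).
Proof.
apply: (iffP (imfsetP _ _ _ _)) => [[[x y] /= a ->]|[x [y [a ->]]]].
  by exists x, y.
by exists (x, y).
Qed.

Lemma edge_clauseC (x y : vertices G) : edge_clause x y = edge_clause y x.
Proof. by rewrite /edge_clause fsetUC. Qed.

(** Each clause is charged to an endpoint of its edge in [S], and a vertex is charged at most [d]
    times. *)
Lemma card_graph_cnf_le d (S : {set vertices G}) :
  (forall v : vertices G, degree v <= d) -> is_cover (@adj _ G) S ->
  #|` graph_cnf G| <= d * #|S|.
Proof.
move=> deg /is_coverP cS.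
pose s := [seq edge_clause v u | v <- enum S, u <- enum (nbhd [set v])].
have sub : {subset graph_cnf G <= s}.
  move=> K /mem_graph_cnf[x [y [a ->]]]; have /orP[xS|yS] := cS x y a.
    by apply/allpairsPdep; exists x, y; rewrite !mem_enum mem_nbhd1.
  apply/allpairsPdep; exists y, x; rewrite !mem_enum mem_nbhd1 adj_sym.
  by rewrite edge_clauseC.
apply: leq_trans (uniq_leq_size (fset_uniq _) sub) _.
rewrite size_allpairs_dep sumnE big_map big_enum /= mulnC -sum_nat_const.
by apply: leq_sum => v _; rewrite -cardE; apply: deg.
Qed.

(** Every wire belongs to one clause: its wire to the output or a wire from one of its literals. An
    upper bound is enough because the exponent of the theorem grows with the size. *)
Lemma csize_cnf_circuit_le (F : cnf X) k :
  (forall K, K \in F -> #|` K| <= k) -> csize (cnf_circuit F) <= k.+1 * #|` F|.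
Proof.
move=> Fk.
pose B (K : F) : {set gate (cnf_circuit F) * gate (cnf_circuit F)} :=
  (Some (inl K), None) |:
  [set (Some (inr l), Some (inl K)) | l in [set l : literals F | val l \in val K]].
have sub : [set p : gate (cnf_circuit F) * gate (cnf_circuit F) | wire p.1 p.2]
    \subset \bigcup_(K : F) B K.
  apply/subsetP => -[[[K|l]|] [[K'|l']|]]; rewrite !inE //= => w.
    by apply/bigcupP; exists K; rewrite ?inE ?eqxx.
  apply/bigcupP; exists K' => //; rewrite inE; apply/orP; right.
  by apply/imsetP; exists l; rewrite ?inE.
apply: leq_trans (subset_leq_card sub) _.
apply: (@leq_trans (\sum_(K : F) #|B K|)).
  elim/big_rec2: _ => [|K A n _ leA]; first by rewrite cards0.
  by rewrite (leq_trans (leq_card_setU _ _).1) // leq_add2l.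
rewrite cardfE mulnC -sum_nat_const; apply: leq_sum => K _.
apply: leq_trans (leq_card_setU _ _).1 _; rewrite cards1 ltnS.
apply: leq_trans (leq_imset_card _ _) _.
apply: leq_trans (Fk _ (valP K)); rewrite cardE -(size_map val).
apply: uniq_leq_size; first by rewrite (map_inj_uniq val_inj) enum_uniq.
by move=> x /mapP[l + ->]; rewrite mem_enum inE.
Qed.

Lemma acyclic_cnf_circuit (F : cnf X) : acyclic (cnf_circuit F).
Proof.
pose rank (g : gate (cnf_circuit F)) : nat :=
  match g with None => 2 | Some (inl _) => 1 | Some (inr _) => 0 end.
apply: (acyclic_rank (rank := rank)).
by case=> [[K|l]|] [[K'|l']|].
Qed.

Lemma eval_graph_cnf f :
  eval (cnf_circuit (graph_cnf G)) f = is_cover (@adj _ G) [set v | f (val v)].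
Proof.
have ac : acyclic (cnf_circuit (graph_cnf G)) by exact: acyclic_cnf_circuit.
rewrite /eval gate_valE //=; apply/forallP/is_coverP => [H x y axy|H].
  have KG : edge_clause x y \in graph_cnf G by apply/mem_graph_cnf; exists x, y.
  have := H (Some (inl [` KG]%fset)); rewrite /= gate_valE //=.
  case/existsP=> -[[//|l]|//] /andP[/=]; rewrite gate_valE //= /lit_label !inE.
  by case/orP=> /eqP -> /= ->; rewrite ?orbT.
case=> [[K|l]|] //=; rewrite gate_valE //=.
have [x [y [axy eK]]] := mem_graph_cnf _ (valP K).
have /orP[] := H x y axy; rewrite inE => fx; apply/existsP.
- have lK : (val x, true) \in val K by rewrite eK !inE eqxx.
  have lF : (val x, true) \in literals (graph_cnf G).
    by apply/bigfcupP; exists (val K); rewrite ?(valP K).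
  by exists (Some (inr [` lF]%fset)); rewrite /= lK gate_valE.
- have lK : (val y, true) \in val K by rewrite eK !inE eqxx orbT.
  have lF : (val y, true) \in literals (graph_cnf G).
    by apply/bigfcupP; exists (val K); rewrite ?(valP K).
  by exists (Some (inr [` lF]%fset)); rewrite /= lK gate_valE.
Qed.

End GraphCNF.

(** * The bound in terms of [g_exp] *)

Lemma f_deg_gt0 (R : realType) d : 0 < f_deg R d.
Proof. by rewrite divr_gt0 // ln_gt0 ?ltr1n // ltrDl invr_gt0 exprn_gt0. Qed.

Lemma powR2_f_deg (R : realType) d : 2 `^ f_deg R d = 1 + 2 ^- d.
Proof.
rewrite /powR pnatr_eq0 /= /f_deg /log2 divfK; last by rewrite gt_eqF ?ln_gt0 ?ltr1n.
by rewrite lnK // posrE addr_gt0 // invr_gt0 exprn_gt0.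
Qed.

Theorem theorem17 (R : realType) (X : countType) (d : nat) (c : R)
    (G : sgraph X) :
  (3 <= d)%N -> 0 < c -> expander c d G -> (2 <= #|` vertices G|)%N ->
  let E := cnf_circuit (graph_cnf G) in
  0 < f_deg R d /\
  2 `^ (g_exp c d * (csize E)%:R - 1) <= (dnnf_size E)%:R.
Proof.
move=> d3 c0 [degG expG] n2 E; split; first exact: f_deg_gt0.
(* [D] is a smallest equivalent DNNF; only its existence with this size matters, since the wire
   bound holds for every equivalent DNNF. *)
rewrite /dnnf_size; case: ex_minnP => s /asboolP[D [dnnfD eqD <-]] _.
have deg (v : vertices G) : (degree v <= d)%N by rewrite -degG; apply: leq_bigmax.
have deg' (v : vertices G) : (#|[set u | @adj _ G v u]| <= d)%N.
  by apply: leq_trans (deg v); rewrite (_ : [set u | _] = nbhd [set v]) //;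
     apply/setP => u; rewrite mem_nbhd1 inE.
have expG' (S : {set vertices G}) : (2 * #|S| <= #|{: vertices G}|)%N ->
    c * #|S|%:R <= #|outer_nbhd (@adj _ G) S|%:R.
  move=> sS; apply: expG; rewrite ler_pdivlMr // mulrC -natrM ler_nat.
  by rewrite cardfE.
have n2' : (1 < #|{: vertices G}|)%N by rewrite -cardfE.
have m0 : (0 < #|` graph_cnf G|)%N.
  have /card_gt0P[v _] : (0 < #|{: vertices G}|)%N by exact: ltnW.
  have : 0 < #|outer_nbhd (@adj _ G) [set v]|%:R :> R.
    by apply: lt_le_trans (expG' [set v] _); rewrite cards1 ?mulr1.
  rewrite ltr0n => /card_gt0P[u]; rewrite inE => /andP[_ /exists_inP[w _ a]].
  rewrite cardfs_gt0; apply/fset0Pn; exists (edge_clause w u).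
  by apply/mem_graph_cnf; exists w, u.
have evD f : eval D f = is_cover (@adj _ G) [set v | f (val v)].
  by rewrite eqD eval_graph_cnf.
have := @dnnf_wires_lower_bound R X D _ _ _ c d _ dnnfD val_inj (@adj_sym _ G)
  (@adj_irrefl _ G) d3 deg' c0 expG' n2' m0 (fun S => card_graph_cnf_le deg) evD.
apply: le_trans; rewrite -powR2_f_deg -powRrM ler_powR ?ler1n //.
have sizeE : (csize E <= 3 * #|` graph_cnf G|)%N.
  apply: csize_cnf_circuit_le => K /mem_graph_cnf[x [y [_ ->]]].
  by rewrite cardfs2; case: eqP.
have d0 : 0 < d%:R :> R by rewrite ltr0n; lia.
have f0 := f_deg_gt0 R d.
(* The [- 1] is given away. With three wires per clause, the 6 in [g_exp] becomes the 2 in the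
   exponent of the wire bound. *)
apply: (@le_trans _ _ (g_exp c d * (3 * #|` graph_cnf G|)%:R)).
  rewrite lerBlDr (le_trans _ (ler_wpDr ler01 (lexx _))) // ler_wpM2l ?ler_nat //.
  by rewrite /g_exp divr_ge0 ?(mulr_ge0 (ltW c0) (ltW f0)) // mulr_ge0 ?exprn_ge0 ?ler0n.
rewrite /g_exp natrM le_eqVlt; apply/orP; left; apply/eqP.
by field; rewrite gt_eqF.
Qed.
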